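(* Let $S$ be a countable inverse semigroup with symmetric generating set $K$, and let $d$ be the path metric on $\Lambda(S,K)$. The pair $(S,K)$ admits a finite labeling if, and only if, for every $R\ge0$ there is a finite $F\subset S$ such that if $s\in S$ satisfies $d(s^*s,s)\le R$ then there is some $m\in F$ such that $ms^*s=s$ (or, equivalently, $m\ge s$).
   Context: An inverse semigroup is a non-empty set $S$ with an associative product such that for each $s\in S$ there is a unique $s^*\in S$ with $ss^*s=s$ and $s^*ss^*=s^*$. The natural partial order is: $s\le t$ iff $s=te$ for some idempotent $e\in S$. Write $x\,\mathcal{L}\,y$ iff $x^*x=y^*y$. A (countable) generating set $K$ is symmetric if $k\in K$ implies $k^*\in K$; generating means every element of $S$ is a finite product of elements of $K$. Graph: $\Lambda(S,K)$ has vertex set $S$, and $x,y\in S$ are joined by an edge labeled by $k\in K$ iff $x\,\mathcal{L}\,y$ and $kx=y$. It is undirected and carries the path metric $d$, with $d=\infty$ between distinct connected components. Finite labeling: $(S,K)$ admits a finite labeling if there are $C\ge 1$ and a finite $K_1\subset K$ such that for all $x,y\in S$ with $x\,\mathcal{L}\,y$ and $y\in Kx$ one has $y\in K_1^p x$ for some $p\in\{1,\dots,C\}$, where $K_1^p$ is the set of words of length $p$ in $K_1$. *)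

(* Defs.v *)
From HB Require Import structures.
From mathcomp Require Import all_boot all_order all_algebra.
From mathcomp Require Import all_classical all_reals all_analysis.

Set Implicit Arguments.
Unset Strict Implicit.
Unset Printing Implicit Defensive.

Import Order.TTheory GRing.Theory Num.Theory.
Local Open Scope classical_set_scope.
Local Open Scope group_scope.

(* [semigroupType] also carries a choice structure, which classically every
   type has. The empty semigroup is excluded by [invsemi_nonempty]. *)
HB.mixin Record Semigroup_isInverse S of Semigroup S := {
  star : S -> S;
  mul_star_mul : forall s : S, s * star s * s = s;
  star_mul_star : forall s : S, star s * s * star s = star s;
  star_unique : forall s t : S, s * t * s = s -> t * s * t = t -> t = star s;
  invsemi_nonempty : inhabited S
}.

#[short(type="invSemigroupType")]
HB.structure Definition InverseSemigroup :=
  {S of Semigroup_isInverse S & Semigroup S}.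

Bind Scope group_scope with InverseSemigroup.sort.

Notation "x ^*" := (star x) : group_scope.

Section InverseSemigroupDefs.
Variable S : invSemigroupType.
Implicit Types (A K : set S) (s t x y k w e : S) (n p : nat).

Definition idempotent_elt e := e * e = e.

Definition natural_le s t := exists2 e, idempotent_elt e & s = t * e.

Definition Lrel x y := x^* * x = y^* * y.

Definition symmetric_set K := forall k, K k -> K k^*.

(* [words A p] is A^p, the set of products of p elements of A. As S need not
   have a unit, words have positive length and A^0 is empty. *)
Inductive words A : nat -> S -> Prop :=
| words_one a : A a -> words A 1 a
| words_cons n a w : A a -> words A n w -> words A n.+1 (a * w).

Definition generating K := forall s, exists p, words K p s.

Definition labeled_edge k x y := Lrel x y /\ k * x = y.

(* Symmetric when K is: see [adjacent_sym]. *)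
Definition adjacent K x y := exists2 k, K k & labeled_edge k x y.

Inductive walk K : nat -> S -> S -> Prop :=
| walk_nil x : walk K 0 x x
| walk_cons n x y z : adjacent K x y -> walk K n y z -> walk K n.+1 x z.

(* The infimum of the empty set is +oo, which is the value of the metric
   between distinct connected components. *)
Definition path_metric (R : realType) K x y : \bar R :=
  ereal_inf [set (n%:R%:E)%R | n in [set n | walk K n x y]].

Definition finite_labeling K :=
  exists (C : nat) (K1 : set S),
    [/\ (1 <= C)%N, K1 `<=` K, finite_set K1 &
      forall x y, Lrel x y -> [set k * x | k in K] y ->
        exists2 p, (1 <= p <= C)%N & [set w * x | w in words K1 p] y].

Lemma starE s t : s * t * s = s -> t * s * t = t -> s^* = t.
Proof. by move=> h1 h2; rewrite -(star_unique _ _ h1 h2). Qed.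

Lemma idempotent_star e : idempotent_elt e -> e^* = e.
Proof. by move=> ee; apply: starE; rewrite !ee. Qed.

Lemma idempotent_star_mul s : idempotent_elt (s^* * s).
Proof. by rewrite /idempotent_elt mulgA star_mul_star. Qed.

Lemma idempotent_mul_star s : idempotent_elt (s * s^* ).
Proof. by rewrite /idempotent_elt mulgA mul_star_mul. Qed.

Lemma idempotent_mul e f :
  idempotent_elt e -> idempotent_elt f -> idempotent_elt (e * f).
Proof.
move=> ee ff; set x := (e * f)^*.
have h1 : e * f * x * (e * f) = e * f by apply: mul_star_mul.
have h2 : x * (e * f) * x = x by apply: star_mul_star.
have hx : x = f * x * e.
  apply: starE.
    have -> : e * f * (f * x * e) * (e * f) = e * (f * f) * x * ((e * e) * f).
      by rewrite !mulgA.
    by rewrite ff ee.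
  have -> : f * x * e * (e * f) * (f * x * e)
      = f * (x * ((e * e) * (f * f)) * x) * e by rewrite !mulgA.
  by rewrite ee ff h2.
have xx : idempotent_elt x.
  rewrite /idempotent_elt [in LHS]hx.
  have -> : f * x * e * (f * x * e) = f * (x * (e * f) * x) * e.
    by rewrite !mulgA.
  by rewrite h2 -hx.
have -> // : e * f = x by rewrite -(idempotent_star xx); apply/esym/starE.
Qed.

Lemma idempotent_comm e f :
  idempotent_elt e -> idempotent_elt f -> e * f = f * e.
Proof.
move=> ee ff; have efi := idempotent_mul ee ff; have fei := idempotent_mul ff ee.
have H a b : idempotent_elt a -> idempotent_elt b -> idempotent_elt (a * b) ->
    a * b * (b * a) * (a * b) = a * b.
  move=> aa bb ab.
  have -> : a * b * (b * a) * (a * b) = a * (b * b) * ((a * a) * b).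
    by rewrite !mulgA.
  by rewrite aa bb ab.
by rewrite -[LHS](idempotent_star efi); apply: starE; apply: H.
Qed.

Lemma star_mul s t : (s * t)^* = t^* * s^*.
Proof.
have comm := idempotent_comm (idempotent_mul_star t) (idempotent_star_mul s).
apply: starE.
  have -> : s * t * (t^* * s^* ) * (s * t) = s * ((t * t^* ) * (s^* * s)) * t.
    by rewrite !mulgA.
  by rewrite comm !mulgA mul_star_mul -!mulgA [t * _]mulgA mul_star_mul.
have -> : t^* * s^* * (s * t) * (t^* * s^* )
    = t^* * ((s^* * s) * (t * t^* )) * s^* by rewrite !mulgA.
by rewrite -comm !mulgA star_mul_star -!mulgA [s^* * _]mulgA star_mul_star.
Qed.

Lemma adjacent_sym K x y :
  symmetric_set K -> adjacent K x y -> adjacent K y x.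
Proof.
move=> symK [k Kk [xLy kx]]; exists k^*; first exact: symK.
split; first exact: esym.
have comm := idempotent_comm (idempotent_star_mul k) (idempotent_mul_star x).
have xE : x^* * x = x^* * (k^* * k) * x by rewrite xLy -kx star_mul !mulgA.
have {}xE : x = x * x^* * (k^* * k) * x.
  by rewrite -[LHS]mul_star_mul -[LHS]mulgA xE !mulgA.
rewrite -kx mulgA [RHS]xE -comm -[RHS]mulgA.
by rewrite mul_star_mul.
Qed.

End InverseSemigroupDefs.

(* Main.v *)
Require Import Defs.
From HB Require Import structures.
From mathcomp Require Import all_boot all_order all_algebra.
From mathcomp Require Import all_classical all_reals all_analysis.
Import Order.TTheory GRing.Theory Num.Theory.
Local Open Scope classical_set_scope.
Local Open Scope group_scope.

(** Multiplying along a walk from [s^* * s] to [s] turns a bound on its length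
    into a bound on the word [m] with [m * (s^* * s) = s]. So if every edge
    [x -- y] can be rewritten as [y = w * x] with [w] a word of length at most
    [C] over a finite alphabet [K1] ([finite_labeling_walk]), the words over
    [K1] of length at most [C * n] handle all nonempty walks of length at most [n], and
    there are finitely many of them ([finite_short_words]). The empty walk needs
    care, because [S] need not have a unit and words have positive length. As
    [K] generates, every vertex [x] has a neighbour ([exists_adjacent]): if
    [a] is the first letter of a word for [x], then [a * a^*] fixes [x] and so
    [a^* * x] is adjacent to [x].
    Walking to that neighbour and back prolongs any walk by two steps, so only
    nonempty walks have to be considered.

    Conversely, an edge [x -- y] labeled by [k] can be translated on the right
    by [x^*] into the edge from the idempotent [x * x^*] to [s = y * x^*], with
    the same label and with [s^* * s = x * x^*] ([labeled_edge_idempotent]).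
    Radius 1 therefore already suffices: it provides a finite set [F]
    containing for every edge some [m] with [m * x * x^* = y * x^*], hence
    [m * x = y]. Writing the finitely many elements of [F] as words over [K]
    uses finitely many letters and bounded lengths ([finite_set_words]). *)

Section Words.
Set Implicit Arguments.
Unset Strict Implicit.
Variable S : invSemigroupType.
Implicit Types (A B F K : set S) (s m w x y : S).

Lemma words_gt0 A p w : words A p w -> (0 < p)%N.
Proof. by case. Qed.

Lemma words_mul A p q v w :
  words A p v -> words A q w -> words A (p + q) (v * w).
Proof.
move=> Av Aw; elim: Av => [a Aa|n a u Aa _ IH]; first exact: words_cons.
by rewrite -mulgA addSn; apply: words_cons.
Qed.

Lemma sub_words A B p w : A `<=` B -> words A p w -> words B p w.
Proof.
move=> AB; elim=> [a /AB|n a u /AB Ba _]; [exact: words_one | exact: words_cons].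
Qed.

Lemma finite_words A p : finite_set A -> finite_set (words A p).
Proof.
move=> finA; elim: p => [|p IH].
  by apply: (@sub_finite_set _ _ _ _ (finite_set0 S)) => w /words_gt0.
have finM : finite_set [set a * w | a in A & w in words A p].
  exact: finite_image2.
apply: (@sub_finite_set _ _ (A `|` [set a * w | a in A & w in words A p])).
  move=> w Aw; inversion Aw as [a Aa|n a u Aa Au]; subst; first by left.
  by right; exists a => //; exists u.
by rewrite finite_setU.
Qed.

Lemma finite_short_words A N :
  finite_set A -> finite_set [set w | exists2 p, (p <= N)%N & words A p w].
Proof.
move=> finA; have -> : [set w | exists2 p, (p <= N)%N & words A p w] =
    \bigcup_(p in `I_N.+1) words A p by [].
by apply: bigcup_finite => // p _; apply: finite_words.
Qed.

Lemma words_finite_letters K p w : words K p w ->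
  exists A, [/\ A `<=` K, finite_set A & words A p w].
Proof.
elim=> [a Ka|n a u Ka _ [A [AK finA Au]]].
  exists [set a]; split; [by move=> _ -> | exact: finite_set1 |].
  exact: words_one.
exists (a |` A); split.
- by move=> x [->|/AK].
- by rewrite finite_setU; split=> //; apply: finite_set1.
- by apply: words_cons; [left | apply: sub_words Au => x; right].
Qed.

Lemma finite_set_words K F : generating K -> finite_set F ->
  exists A N, [/\ A `<=` K, finite_set A &
    forall m, F m -> exists2 p, (p <= N)%N & words A p m].
Proof.
move=> genK /finite_seqP[l ->] {F}.
elim: l => [|m l [A [N [AK finA lA]]]].
  by exists set0, 0%N; split=> //; apply: sub0set.
have [p /words_finite_letters[B [BK finB Bm]]] := genK m.
exists (A `|` B), (maxn N p); split.
- by move=> x [/AK|/BK].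
- by rewrite finite_setU.
move=> x /=; rewrite inE => /predU1P[->|/lA[q qN Ax]].
  by exists p; [rewrite leq_maxr | apply: sub_words Bm => y; right].
exists q; first by rewrite leq_max qN.
by apply: sub_words Ax => y; left.
Qed.

End Words.

Section Graph.
Set Implicit Arguments.
Unset Strict Implicit.
Variable S : invSemigroupType.
Implicit Types (K : set S) (e m s t x y k w : S).

Lemma star_star s : s^*^* = s.
Proof. by apply: starE; [apply: star_mul_star | apply: mul_star_mul]. Qed.

Lemma mul_star_mulA s : s * (s^* * s) = s.
Proof. by rewrite mulgA mul_star_mul. Qed.

Lemma natural_leP m s : m * (s^* * s) = s <-> natural_le s m.
Proof.
split=> [ms|[e ee ->]].
  by exists (s^* * s); [apply: idempotent_star_mul | rewrite ms].
rewrite star_mul (idempotent_star ee).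
have -> : m * (e * m^* * (m * e)) = m * (e * (m^* * m)) * e by rewrite !mulgA.
rewrite (idempotent_comm ee (idempotent_star_mul m)).
by rewrite mulgA mul_star_mulA -mulgA ee.
Qed.

(** A letter [k] that starts a word for [x] satisfies [k * k^* * x = x], so left
    multiplication by [k^*] does not leave the L-class of [x]. *)
Lemma exists_adjacent K x : symmetric_set K -> generating K ->
  exists y, Defs.adjacent K x y.
Proof.
move=> symK genK.
have [k Kk kx] : exists2 k, K k & k * k^* * x = x.
  have [p Kx] := genK x; inversion Kx as [a Ka|n a u Ka _]; subst.
    by exists x => //; apply: mul_star_mul.
  by exists a => //; rewrite mulgA mul_star_mul.
exists (k^* * x), k^*; first exact: symK.
by split=> //; rewrite /Lrel star_mul star_star -mulgA [k * _]mulgA kx.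
Qed.

Lemma labeled_edge_idempotent k x y : labeled_edge k x y ->
  let s := y * x^* in s^* * s = x * x^* /\ labeled_edge k (s^* * s) s.
Proof.
move=> [xLy kx] s.
have sE : s^* * s = x * x^*.
  rewrite /s star_mul star_star.
  have -> : x * y^* * (y * x^* ) = x * (y^* * y) * x^* by rewrite !mulgA.
  by rewrite -xLy mul_star_mulA.
split=> //; split.
  by rewrite /Lrel (idempotent_star (idempotent_star_mul s)) idempotent_star_mul.
by rewrite sE mulgA kx.
Qed.

Lemma finite_labeling_walk K C (K1 : set S) n x y :
  (forall x y, Lrel x y -> [set k * x | k in K] y ->
     exists2 p, (1 <= p <= C)%N & [set w * x | w in words K1 p] y) ->
  walk K n.+1 x y ->
  exists p w, [/\ (p <= C * n.+1)%N, words K1 p w & w * x = y].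
Proof.
move=> labK.
have edge u v : Defs.adjacent K u v ->
    exists p w, [/\ (p <= C)%N, words K1 p w & w * u = v].
  move=> [k Kk [uLv kv]].
  have [|p /andP[_ pC] [w Kw wu]] := labK u v uLv; first by exists k.
  by exists p, w.
elim: n x => [|n IH] x xy; inversion xy as [|n' x' z y' xz zy]; subst.
  have [p [w [pC Kw wx]]] := edge _ _ xz.
  by exists p, w; inversion zy; subst; rewrite muln1.
have [p [w [pC Kw wx]]] := edge _ _ xz.
have [q [v [qC Kv vz]]] := IH _ zy.
exists (q + p)%N, (v * w); split; last by rewrite -mulgA wx.
  by rewrite mulnS addnC leq_add.
exact: words_mul.
Qed.

Lemma path_metric_walk (R : realType) K n x y :
  walk K n x y -> (path_metric R K x y <= n%:R%:E)%E.
Proof. by move=> xy; apply: ereal_inf_lbound; exists n. Qed.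

(** Only a bound that depends on the radius alone is needed, so a walk of length
    below [r + 1], which the infimum yields at once, serves as well as a shortest
    one. *)
Lemma walk_path_metric (R : realType) K (r : R) : (0 <= r)%R ->
  exists N, forall x y, (path_metric R K x y <= r%:E)%E ->
    exists2 n, (n <= N)%N & walk K n x y.
Proof.
move=> r0; have r1_ge0 : (0 <= r + 1)%R by rewrite addr_ge0.
exists (Num.bound (r + 1)%R) => x y xy.
have : (path_metric R K x y < (r + 1)%:E)%E.
  by apply: le_lt_trans xy _; rewrite lte_fin ltrDl.
move=> /ereal_inf_lt[_ [n nxy <-]]; rewrite lte_fin => nr.
exists n => //; rewrite -(ler_nat R) ltW// (lt_trans nr)//.
exact: archi_boundP.
Qed.

End Graph.

Theorem proposition3p20 (R : realType) (S : invSemigroupType) (K : set S)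
  (S_countable : countable [set: S])
  (K_symmetric : symmetric_set K) (K_generating : generating K) :
  (finite_labeling K <->
   forall r : R, (0 <= r)%R ->
     exists2 F : set S, finite_set F &
       forall s : S, (path_metric R K (s^* * s) s <= r%:E)%E ->
         exists2 m, F m & m * (s^* * s) = s)
  /\ (forall m s : S, m * (s^* * s) = s <-> natural_le s m).
Proof.
split; last exact: natural_leP.
split=> [[C [K1 [_ _ finK1 labK]]] r r0|boundK].
  have [N walkN] := walk_path_metric K r0.
  exists [set w | exists2 p, (p <= C * N.+2)%N & words K1 p w].
    exact: finite_short_words.
  move=> s /walkN[n nN walk_s].
  have [y ey] := exists_adjacent (s^* * s) K_symmetric K_generating.
  (* The detour through [y] makes the walk nonempty also when [s] is
     idempotent. *)
  have walk_s2 : walk K n.+2 (s^* * s) s.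
    exact: walk_cons ey (walk_cons (adjacent_sym K_symmetric ey) walk_s).
  have [p [w [pC Kw ws]]] := finite_labeling_walk labK walk_s2.
  by exists w => //; exists p => //; rewrite (leq_trans pC)// leq_mul2l !ltnS nN orbT.
have [F finF FK] := boundK 1%R ler01.
have [K1 [N [K1K finK1 FK1]]] := finite_set_words K_generating finF.
exists N.+1, K1; split=> // x y xLy [k Kk kx].
have [sE edge_s] := labeled_edge_idempotent (conj xLy kx).
have [|m Fm ms] := FK (y * x^* ).
  apply: (@path_metric_walk S R K 1); apply: walk_cons (walk_nil _ _).
  by exists k.
have [p pN K1m] := FK1 m Fm.
exists p; first by rewrite (words_gt0 K1m) leqW.
exists m => //.
by rewrite -(mul_star_mul x) mulgA -sE ms -mulgA xLy mul_star_mulA.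
Qed.
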